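(* Let $n\ge 5$ be an integer with $n\equiv 1$ or $5 \pmod{20}$. Then there exists a configuration $(1,5)$ $GDD\left(n,2,6;n,\frac{n-1}{2}\right)$.
   Context: A $GDD(n,2,6;\lambda_1,\lambda_2)$ is a finite collection (repetitions allowed) of $6$-element subsets, called blocks, of a $2n$-element set $X$ partitioned into two groups of size $n$, such that every point lies in the same number $r$ of blocks, any two distinct points of the same group lie together in exactly $\lambda_1$ blocks, and any two points from different groups lie together in exactly $\lambda_2$ blocks. It has configuration $(1,5)$ if every block has exactly $1$ point in one of the two groups and $5$ points in the other (which group contains the single point may depend on the block). *)

(* Defs.v *)
From mathcomp Require Import all_boot.

Set Implicit Arguments.
Unset Strict Implicit.
Unset Printing Implicit Defensive.

(** [is_gdd n m k l1 l2 P B]: the groups [P] and the blocks [B] form a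
    GDD(n, m, k; l1, l2) on the point set [T].  The collection of blocks is a
    sequence, so repeated blocks are counted with multiplicity by [count]. *)
Record is_gdd (T : finType) (n m k l1 l2 : nat)
    (P : {set {set T}}) (B : seq {set T}) : Prop := IsGDD {
  gdd_points : #|T| = m * n;
  gdd_partition : partition P [set: T];
  gdd_num_groups : #|P| = m;
  gdd_group_size : forall G : {set T}, G \in P -> #|G| = n;
  gdd_block_size : forall b : {set T}, b \in B -> #|b| = k;
  gdd_replication : exists r : nat,
    forall x : T, count (fun b : {set T} => x \in b) B = r;
  gdd_same_group : forall (G : {set T}) (x y : T),
    G \in P -> x \in G -> y \in G -> x != y ->
    count (fun b : {set T} => (x \in b) && (y \in b)) B = l1;
  gdd_diff_group : forall (G H : {set T}) (x y : T),
    G \in P -> H \in P -> G != H -> x \in G -> y \in H ->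
    count (fun b : {set T} => (x \in b) && (y \in b)) B = l2
}.

(** The groups [G] and [H] are chosen block by block, so which of the two
    groups carries the [s] points may vary with [b]. *)
Definition has_configuration (T : finType) (s t : nat)
    (P : {set {set T}}) (B : seq {set T}) : Prop :=
  forall b : {set T}, b \in B ->
    exists G H : {set T},
      [/\ G \in P, H \in P, G != H, #|b :&: G| = s & #|b :&: H| = t].

(* Main.v *)
Require Import Defs.
From mathcomp Require Import all_boot all_algebra all_field zify.

Set Implicit Arguments.
Unset Strict Implicit.
Unset Printing Implicit Defensive.
Import GRing.Theory.

(** Given an (n,5,1)-design on each side, take [n] copies of it, one for each
    point of the other side, and add that point to all the blocks of its copy.
    Pairs on one side are then covered [n] times, and a pair across is covered
    once for every block through either of its points, (n-1)/4 + (n-1)/4 times.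

    This needs Hanani's theorem: (n,5,1)-designs exist for n = 1, 5 (mod 20).
    Deleting a point from a (4r+1,5,1)-design leaves a 5-GDD of type 4^r, and
    the set of such r is PBD-closed.  A truncated transversal design TD(6,m),
    possibly with a point at infinity, is a PBD with blocks of size 5, 6, m+e
    and h+e on 5m+h+e points; the linear TD(6,m) over Z/m (m coprime to 6) and
    over the fields of order 9 and 16 reduce everything to finitely many r,
    which are settled by difference families found by computer. *)

(** * Designs of index one and their transport along bijections *)

Definition through (T : finType) (B : {set {set T}}) (x y : T) : {set {set T}} :=
  [set b in B | (x \in b) && (y \in b)].

Lemma through_sym (T : finType) (B : {set {set T}}) (x y : T) :
  through B x y = through B y x.
Proof. by apply/setP=> b; rewrite !inE [(x \in b) && _]andbC. Qed.

Lemma through_uniq (T : finType) (B : {set {set T}}) (x y : T) (b c : {set T}) :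
  #|through B x y| = 1 -> b \in B -> x \in b -> y \in b ->
  c \in B -> x \in c -> y \in c -> b = c.
Proof.
move=> /eqP/cards1P[d Hd] Bb xb yb Bc xc yc.
have: b \in through B x y by rewrite !inE Bb xb.
have: c \in through B x y by rewrite !inE Bc xc.
by rewrite Hd !inE => /eqP-> /eqP->.
Qed.

Lemma throughP (T : finType) (B : {set {set T}}) (x y : T) :
  #|through B x y| = 1 -> exists b, [/\ b \in B, x \in b & y \in b].
Proof.
move=> /eqP/cards1P[b Hb]; have := set11 b.
by rewrite -Hb !inE => /and3P[? ? ?]; exists b.
Qed.

Lemma card_through1 (T : finType) (B : {set {set T}}) (x y : T) (b : {set T}) :
  b \in B -> x \in b -> y \in b ->
  (forall c, c \in B -> x \in c -> y \in c -> c = b) -> #|through B x y| = 1.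
Proof.
move=> Bb xb yb Hu; apply/eqP/cards1P; exists b; apply/setP=> c; rewrite !inE.
by apply/and3P/eqP=> [[? ? ?]|->]; [apply: Hu | split].
Qed.

(** Block sizes are unrestricted, 0 and 1 included, so that a truncated design needs no cleaning
    up. *)
Definition pbd (T : finType) (B : {set {set T}}) : Prop :=
  forall x y : T, x != y -> #|through B x y| = 1.

Definition bibd5 (v : nat) : Prop :=
  exists (T : finType) (B : {set {set T}}),
    [/\ #|T| = v, forall b, b \in B -> #|b| = 5 & pbd B].

(* The groups are the fibers of [f]. *)
Definition gdd5 (T : finType) (U : eqType) (f : T -> U) (B : {set {set T}}) : Prop :=
  [/\ forall b, b \in B -> #|b| = 5,
      forall b, b \in B -> {in b &, injective f} &
      forall x y, f x != f y -> #|through B x y| = 1].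

Definition gdd5_type4 (r : nat) : Prop :=
  exists B : {set {set 'I_r * 'I_4}}, gdd5 (fun p => p.1) B.

Lemma gdd5_imset (T T' : finType) (U U' : eqType) (f : T -> U) (f' : T' -> U')
    (h : T -> T') (B : {set {set T}}) :
  bijective h -> (forall x y, (f' (h x) == f' (h y)) = (f x == f y)) ->
  gdd5 f B -> gdd5 f' [set h @: (b : {set T}) | b in B].
Proof.
move=> [g hK gK] Hf [B5 Binj B1]; have hinj := can_inj hK.
split=> [b /imsetP[c Bc ->]|b /imsetP[c Bc ->]|x y].
- by rewrite card_imset // B5.
- move=> _ _ /imsetP[x cx ->] /imsetP[y cy ->] /eqP; rewrite Hf => /eqP E.
  by rewrite (Binj _ Bc x y).
- rewrite -[x]gK -[y]gK Hf => /B1 H1.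
  have [b [Bb xb yb]] := throughP H1.
  apply: (@card_through1 _ _ _ _ (h @: b)); rewrite ?imset_f //.
  move=> _ /imsetP[c Bc ->]; rewrite !mem_imset // => xc yc.
  by rewrite (through_uniq H1 Bb xb yb Bc xc yc).
Qed.

Lemma card_fibers (T X : finType) (f : T -> X) (k : nat) :
  (forall c : X, #|[set x | f x == c]| = k) -> #|T| = #|X| * k.
Proof.
move=> Hk; rewrite -sum1_card (partition_big f xpredT) //= -sum_nat_const.
apply: eq_bigr => c _; rewrite -(Hk c) -sum1_card.
by apply: eq_bigl => x; rewrite inE.
Qed.

(** Numbering the points inside each fiber supplies the coordinate in ['I_4]; together with the
    index of the fiber it gives the required bijection. *)
Lemma gdd5_type4_of (T X : finType) (f : T -> X) (B : {set {set T}}) :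
  (forall c : X, #|[set x | f x == c]| = 4) -> gdd5 f B -> gdd5_type4 #|X|.
Proof.
move=> H4 HB.
pose F c := [set x | f x == c].
have lt4 x : index x (enum (F (f x))) < 4.
  by rewrite -[X in _ < X](H4 (f x)) cardE index_mem mem_enum inE.
pose h x := (enum_rank (f x), Ordinal (lt4 x)).
have hinj : injective h.
  move=> x y [/enum_rank_inj Exy]; rewrite -Exy => E.
  have Hm z : f z = f x -> z \in enum (F (f x)) by move=> <-; rewrite mem_enum inE.
  by rewrite -(nth_index x (Hm x erefl)) E nth_index // Hm.
have hbij : bijective h.
  by apply: inj_card_bij => //; rewrite (card_fibers H4) card_prod !card_ord.
exists [set h @: (b : {set T}) | b in B]; apply: (gdd5_imset hbij _ HB) => x y /=.
by rewrite (inj_eq enum_rank_inj).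
Qed.

Lemma gdd5_type4_on (X : finType) : gdd5_type4 #|X| ->
  exists B : {set {set X * 'I_4}}, gdd5 (fun p => p.1) B.
Proof.
move=> [B HB]; pose h (p : 'I_#|X| * 'I_4) := (enum_val p.1, p.2).
exists [set h @: (b : {set _}) | b in B]; apply: gdd5_imset HB => [|x y].
  exists (fun p => (enum_rank p.1, p.2)) => -[x i] /=; rewrite /h /=.
    by rewrite enum_valK.
  by rewrite enum_rankK.
by rewrite (inj_eq enum_val_inj).
Qed.

(** * PBD-closure, and passage to designs on 4r + 1 points *)

(** Wilson's fundamental construction with weight 4: every point is replaced by four, and over each
    block [b] a GDD of type 4^|b| is placed. Two points over distinct base points lie above exactly
    one block, and the GDD there covers them once. *)
Lemma pbd_gdd5_type4 (T : finType) (B : {set {set T}}) :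
  pbd B -> (forall b, b \in B -> gdd5_type4 #|b|) -> gdd5_type4 #|T|.
Proof.
move=> HB H4.
(* [F b] is the family placed over [b]; outside [B] the empty family is a default. *)
have /fin_all_exists [F HF] (b : {set T}) : exists F : {set {set T * 'I_4}},
    b \in B -> [/\ forall c, c \in F -> #|c| = 5,
      forall c, c \in F -> {in c &, injective (fun p => p.1)},
      forall c p, c \in F -> p \in c -> p.1 \in b &
      forall p q, p.1 \in b -> q.1 \in b -> p.1 != q.1 -> #|through F p q| = 1].
  case Bb: (b \in B); last by exists set0.
  have := H4 b Bb; rewrite -card_sig => /gdd5_type4_on [D [D5 Dinj D1]].
  pose h (p : {x | x \in b} * 'I_4) := (val p.1, p.2).
  have hinj : injective h by move=> [x i] [y j] [/val_inj -> ->].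
  exists [set h @: (c : {set _}) | c in D] => _; split.
  - by move=> _ /imsetP[c Dc ->]; rewrite card_imset // D5.
  - move=> _ /imsetP[c Dc ->] _ _ /imsetP[x cx ->] /imsetP[y cy ->] /= /val_inj E.
    by rewrite (Dinj _ Dc x y).
  - by move=> _ _ /imsetP[c Dc ->] /imsetP[x cx ->]; apply: (valP x.1).
  - move=> [p i] [q j] /= bp bq npq.
    have npq' : (Sub p bp : {x | x \in b}) != Sub q bq by rewrite -val_eqE.
    have H1 := D1 (Sub p bp, i) (Sub q bq, j) npq'.
    have [c [Dc pc qc]] := throughP H1.
    have Hm (u : T) (bu : u \in b) k (e : {set {x | x \in b} * 'I_4}) :
        ((u, k) \in h @: e) = ((Sub u bu, k) \in e).
      by rewrite -(mem_imset _ _ hinj).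
    apply: (card_through1 (b := h @: c)); rewrite ?imset_f // ?Hm //.
    move=> _ /imsetP[e De ->]; rewrite (Hm p bp) (Hm q bq) => pe qe.
    by rewrite (through_uniq H1 Dc pc qc De pe qe).
suff : gdd5 (fun p : T * 'I_4 => p.1) (\bigcup_(b in B) F b).
  apply: gdd5_type4_of => c; rewrite -[RHS](card_ord 4).
  rewrite -(card_imset predT (f := fun i : 'I_4 => (c, i))); last by move=> i j [].
  apply: eq_card => -[x i]; rewrite inE /=.
  apply/eqP/imsetP => [->|[j _ [->]]] //; by exists i.
split=> [c /bigcupP[b Bb Fc]|c /bigcupP[b Bb Fc]|p q npq].
- by have [H _ _ _] := HF b Bb; apply: H.
- by have [_ H _ _] := HF b Bb; apply: H.
have H1 := HB _ _ npq.
have [b [Bb pb qb]] := throughP H1.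
have [_ _ Hsub /(_ p q pb qb npq) H2] := HF b Bb.
have [c [Fc pc qc]] := throughP H2.
apply: (card_through1 (b := c)) => //; first by apply/bigcupP; exists b.
move=> e /bigcupP[b' Bb' Fe] pe qe.
have [_ _ Hsub' _] := HF b' Bb'.
have Ebb : b = b'.
  by apply: (through_uniq H1 Bb pb qb Bb'); [apply: (Hsub' e p) | apply: (Hsub' e q)].
by apply: (through_uniq H2 _ pe qe Fc); rewrite // Ebb.
Qed.

(** Truncation: every block is cut down to [S]. Distinct blocks with the same trace merge, but such
    a trace has at most one point, so no pair is affected. *)
Lemma pbd_trace_gdd5_type4 (T : finType) (S : {set T}) (B : {set {set T}}) :
  {in S &, forall x y, x != y -> #|through B x y| = 1} ->
  (forall b, b \in B -> gdd5_type4 #|b :&: S|) -> gdd5_type4 #|S|.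
Proof.
move=> HB H4; rewrite -card_sig.
pose h (b : {set T}) := [set x : {x | x \in S} | val x \in b].
apply: (@pbd_gdd5_type4 _ (h @: B)) => [x y nxy|_ /imsetP[b Bb ->]].
  have H1 := HB _ _ (valP x) (valP y) nxy.
  have [b [Bb xb yb]] := throughP H1.
  apply: (card_through1 (b := h b)); rewrite ?imset_f ?inE //.
  move=> _ /imsetP[c Bc ->]; rewrite !inE => xc yc.
  by rewrite (through_uniq H1 Bb xb yb Bc xc yc).
suff -> : #|h b| = #|b :&: S| by apply: H4.
rewrite -(card_imset _ val_inj); apply: eq_card => x; rewrite !inE.
apply/imsetP/andP => [[y]|[xb xS]]; first by rewrite inE => ? ->; split=> //; apply: valP.
by exists (Sub x xS); rewrite ?inE.
Qed.

(** A point at infinity, [None], extends every group of size 4 to a block of size 5. *)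
Lemma bibd5_of_gdd5_type4 (r : nat) : gdd5_type4 r -> bibd5 (4 * r).+1.
Proof.
move=> [D [D5 Dinj D1]].
pose fib (x : 'I_r) : {set option ('I_r * 'I_4)} :=
  None |: [set Some (x, i) | i : 'I_4].
have fibP x p : (Some p \in fib x) = (p.1 == x).
  rewrite !inE; apply/imsetP/eqP => [[i _ [->]] //|<-].
  by exists p.2 => //; case: p.
have fib0 x : None \in fib x by rewrite !inE.
pose B := [set some @: (b : {set _}) | b in D] :|: [set fib x | x : 'I_r].
have someD p (b : {set 'I_r * 'I_4}) : (Some p \in some @: b) = (p \in b).
  by rewrite mem_imset //; apply: Some_inj.
have someN (b : {set 'I_r * 'I_4}) : (None \in some @: b) = false.
  by apply/negbTE/negP => /imsetP[].
have BP (P : {set option ('I_r * 'I_4)} -> Prop) :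
    (forall b, b \in D -> P (some @: b)) -> (forall x, P (fib x)) ->
    forall b, b \in B -> P b.
  by move=> H1 H2 b /setUP[/imsetP[c Dc ->]|/imsetP[x _ ->]]; auto.
have Bfib x : fib x \in B by rewrite inE orbC imset_f.
have Bsome b : b \in D -> some @: b \in B by move=> Db; rewrite inE imset_f.
exists (option ('I_r * 'I_4) : finType), B; split.
- by rewrite card_option card_prod !card_ord mulnC.
- apply: BP => [b Db|x]; first by rewrite card_imset ?D5 //; apply: Some_inj.
  rewrite cardsU1 card_imset ?card_ord //; last by move=> i j [].
  by case: imsetP => [[]|].
- have HN p : #|through B None (Some p)| = 1.
    apply: (card_through1 (b := fib p.1)) => //; first by rewrite fibP.
    by apply: BP => [b Db|x]; rewrite ?someN // fibP => _ /eqP->.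
  move=> [p|] [q|] //; [|by rewrite through_sym].
  rewrite (inj_eq Some_inj) => npq.
  have [E|N] := eqVneq p.1 q.1.
    apply: (card_through1 (b := fib p.1)) => //; rewrite ?fibP ?E //.
    apply: BP => [b Db|x]; last by rewrite !fibP => _ /eqP->.
    rewrite !someD => pb qb; case/eqP: npq.
    exact: (Dinj _ Db).
  have H1 := D1 _ _ N.
  have [b [Db pb qb]] := throughP H1.
  apply: (card_through1 (b := some @: b)); rewrite ?someD ?Bsome //.
  apply: BP => [c Dc|x]; last by rewrite !fibP => /eqP<- /eqP E; rewrite E eqxx in N.
  by rewrite !someD => pc qc; rewrite (through_uniq H1 Db pb qb Dc pc qc).
Qed.

(** A point [o] is deleted: the blocks through [o], which form the type [X], become the groups, and
    the blocks missing [o] are kept. *)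
Lemma gdd5_type4_of_bibd5 (r : nat) : bibd5 (4 * r).+1 -> gdd5_type4 r.
Proof.
move=> [T [B [cT B5 HB]]].
have /card_gt0P [o _] : 0 < #|T| by rewrite cT.
pose X : finType := {b : {set T} | (b \in B) && (o \in b)}.
pose T' : finType := {x : T | x != o}.
have /fin_all_exists [f fP] (x : T') : exists b : X, val x \in val b.
  have [b [Bb xb ob]] := throughP (HB _ _ (valP x)).
  by exists (Sub b (introT andP (conj Bb ob))).
have fE (x : T') (b : X) : (f x == b) = (val x \in val b).
  apply/eqP/idP => [<- //|xb]; apply: val_inj.
  have /andP[Bb ob] := valP b; have /andP[Bf of'] := valP (f x).
  exact: (through_uniq (HB _ _ (valP x)) Bf (fP x) of' Bb xb ob).
have H4 (c : X) : #|[set x | f x == c]| = 4.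
  have /andP[Bc oc] := valP c.
  rewrite -(card_imset _ val_inj).
  have -> : [set val x | x in [set x | f x == c]] = val c :\ o.
    apply/setP=> x; rewrite !inE; apply/imsetP/andP => [[y]|[xo xc]].
      by rewrite inE fE => ? ->; split=> //; apply: (valP y).
    by exists (Sub x xo); rewrite ?inE ?fE.
  by have := cardsD1 o (val c); rewrite B5 // oc => -[].
have -> : r = #|X|.
  have := card_fibers H4; rewrite card_sig.
  have := cardC1 o; rewrite cT /= => ->; lia.
pose h (b : {set T}) := [set x : T' | val x \in b].
apply: (gdd5_type4_of (B := h @: [set b in B | o \notin b]) H4); split.
- move=> _ /imsetP[b + ->]; rewrite inE => /andP[Bb ob].
  rewrite -(B5 b Bb) -(card_imset _ val_inj); apply: eq_card => x.
  apply/imsetP/idP => [[y]|xb]; first by rewrite inE => ? ->.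
  have xo : x != o by apply: contraNneq ob => <-.
  by exists (Sub x xo); rewrite ?inE.
- move=> _ /imsetP[b + ->] x y; rewrite inE => /andP[Bb ob].
  rewrite !inE => xb yb E; apply/eqP/idPn => nxy.
  have /andP[Bf of'] := valP (f x).
  have Eb := through_uniq (HB _ _ nxy) Bb xb yb Bf (fP x).
  by rewrite Eb ?of' // E fP in ob.
- move=> x y nf.
  have nxy : x != y by apply: contraNneq nf => ->.
  have H1 := HB _ _ nxy.
  have [b [Bb xb yb]] := throughP H1.
  have ob : o \notin b.
    apply: contraNN nf => ob; have Hb := introT andP (conj Bb ob).
    have /eqP-> : f x == Sub b Hb by rewrite fE.
    by rewrite eq_sym fE.
  apply: (card_through1 (b := h b)); rewrite ?inE //.
    by apply: imset_f; rewrite inE Bb.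
  move=> _ /imsetP[c + ->]; rewrite !inE => /andP[Bc _] xc yc.
  by rewrite (through_uniq H1 Bb xb yb Bc xc yc).
Qed.

(** * Linear transversal designs with six groups and their truncation *)

(** This encodes a linear TD(6, m): the block given by a pair (a, b) has the point a + c_i b in the
    i-th of five groups and b in the sixth. The blocks through two points of different groups solve
    a linear system, which has one solution because the differences c_i - c_j are units. *)
Definition has_td6 (m : nat) : Prop :=
  exists (R : finComUnitRingType) (c : 'I_5 -> R),
    #|R| = m /\ forall i j, i != j -> (c i - c j)%R \is a GRing.unit.

(** The elements 0, ..., 4 of Z/m serve: up to sign their differences are 1, 2, 3 and 4, whose only
    prime factors are 2 and 3. *)
Lemma has_td6_coprime (m : nat) : 1 < m -> coprime m 6 -> has_td6 m.
Proof.
move=> m1 m6; exists 'Z_m, (fun i => (i : nat)%:R%R); split.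
  by rewrite card_ord Zp_cast.
have Hu k : 0 < k < 5 -> (k%:R : 'Z_m)%R \is a GRing.unit.
  rewrite unitZpE //; move: m6; rewrite (coprimeMr _ 2 3) => /andP[m2 m3].
  move: k => [|[|[|[|[|k]]]]] // _; first exact: coprimen1.
  by rewrite (coprimeMr _ 2 2) m2.
move=> i j; wlog ltij : i j / i < j => [H nij|_].
  case: (ltngtP i j) => E; first exact: H.
    by rewrite -unitrN opprB; apply: H; rewrite // eq_sym.
  by rewrite (val_inj E) eqxx in nij.
rewrite -unitrN opprB -natrB 1?ltnW //; apply: Hu.
by rewrite subn_gt0 ltij /= (leq_ltn_trans (leq_subr _ _)).
Qed.

Lemma has_td6_primepow (p k : nat) : prime p -> 0 < k -> 5 <= p ^ k -> has_td6 (p ^ k).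
Proof.
move=> pp k0 h5; have [F _ cF] := PrimePowerField pp k0.
have h : 5 <= #|F| by rewrite cF.
exists F, (fun i => enum_val (widen_ord h i)); split=> // i j nij.
by rewrite unitfE subr_eq0 (inj_eq enum_val_inj) -val_eqE.
Qed.

(** This separates the three kinds of points of a truncated design: the point at infinity, the full
    groups indexed by [U], and the truncated group [None]. *)
Lemma card_option_prod (U R : finType) (A : {set option (option U * R)}) :
  #|A| = (None \in A) + (\sum_(u : U) #|[set z | Some (Some u, z) \in A]| +
    #|[set z | Some (None, z) \in A]|).
Proof.
have card_pair (V : finType) (C : {set V * R}) :
    #|C| = \sum_(u : V) #|[set z | (u, z) \in C]|.
  rewrite -sum1_card (eq_bigl (fun p => (p.1, p.2) \in C)); last by case.
  rewrite -(pair_big_dep xpredT (fun u z => (u, z) \in C) (fun _ _ => 1)) /=.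
  by apply: eq_bigr => u _; rewrite -sum1_card; apply: eq_bigl => z; rewrite inE.
rewrite (cardsD1 None); congr (_ + _).
have -> : A :\ None = some @: [set p | Some p \in A].
  apply/setP=> -[p|]; last by rewrite !inE; apply/esym/negP => /imsetP[].
  by rewrite mem_imset ?inE //; apply: Some_inj.
rewrite card_imset; last exact: Some_inj.
rewrite card_pair (bigD1 None) //= addnC (reindex_omap some id) /=; last by case.
congr (_ + _); last by apply: eq_card => z; rewrite !inE.
by apply: eq_big => [u|u _]; [rewrite eqxx | apply: eq_card => z; rewrite !inE].
Qed.

Lemma card_enum_rank_lt (R : finType) (h : nat) : h <= #|R| ->
  #|[set z : R | enum_rank z < h]| = h.
Proof.
move=> hR; rewrite -(card_imset _ enum_rank_inj) -[RHS]card_ord.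
rewrite -(card_imset predT (f := widen_ord hR)); last first.
  by move=> i j /(congr1 val) /= /val_inj.
apply: eq_card => i; apply/imsetP/imsetP => [[z]|[j _ ->]].
  by rewrite inE => zh ->; exists (Ordinal zh) => //; apply: val_inj.
by exists (enum_val (widen_ord hR j)); rewrite ?inE enum_valK //=.
Qed.

(* One group of a TD(6, m) is truncated to [h] points, and all the groups get a
   common point at infinity if [e] holds. *)
Lemma gdd5_type4_td (m h : nat) (e : bool) :
  has_td6 m -> h <= m -> gdd5_type4 5 -> gdd5_type4 6 ->
  gdd5_type4 (m + e) -> gdd5_type4 (h + e) -> gdd5_type4 (5 * m + h + e).
Proof.
move=> [R [c [<- cU]]] hm H5 H6 Hm Hh.
pose T : finType := option (option 'I_5 * R).
(* [ev p o] is the coordinate of the point where the line [p] meets the group [o]. *)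
pose ev (p : R * R) (o : option 'I_5) : R :=
  (if o is Some i then p.1 + c i * p.2 else p.2)%R.
have evP o o' z z' : o != o' -> exists p,
    [/\ ev p o = z, ev p o' = z' & forall q, ev q o = z -> ev q o' = z' -> q = p].
  case: o o' => [i|] [j|] //= nij.
  - have U := cU i j nij; pose y := ((z - z') / (c i - c j))%R.
    have Ey : ((c i - c j) * y = z - z')%R by rewrite mulrC mulrVK.
    exists (z - c i * y, y)%R => /=; split; first by rewrite subrK.
      by rewrite -addrA -[(c j * y)%R]opprK -opprD -mulrBl Ey opprB addrC subrK.
    move=> [a b] /= Hz Hz'.
    suff -> : y = b by rewrite -Hz addrK.
    by apply: (mulrI U); rewrite Ey -Hz -Hz' opprD addrACA subrr add0r mulrBl.
  - exists (z - c i * z', z')%R => /=; split=> //; first by rewrite subrK.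
    by move=> [a b] /= <- <-; rewrite addrK.
  - exists (z' - c j * z, z)%R => /=; split=> //; first by rewrite subrK.
    by move=> [a b] /= <- <-; rewrite addrK.
(* Here every group contains the point at infinity; [S] decides by [e] whether that point
   survives. *)
pose G o : {set T} := [set p | if p is Some q then q.1 == o else true].
pose L p : {set T} := [set q | if q is Some u then u.2 == ev p u.1 else false].
pose S : {set T} := [set q | match q with
  | None => e | Some (Some _, _) => true | Some (None, z) => enum_rank z < h end].
have cS : #|S| = 5 * #|R| + h + e.
  rewrite card_option_prod inE addnC; congr (_ + _ + _).
    rewrite (eq_bigr (fun=> #|R|)) => [|i _]; first by rewrite sum_nat_const card_ord.
    by apply: eq_card => z; rewrite !inE.
  rewrite -[RHS](card_enum_rank_lt hm); by apply: eq_card => z; rewrite !inE.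
rewrite -cS.
have GP o q : (Some q \in G o) = (q.1 == o) by rewrite inE.
have GN o : None \in G o by rewrite inE.
have LP p q : (Some q \in L p) = (q.2 == ev p q.1) by rewrite inE.
have LN p : (None \in L p) = false by rewrite inE.
pose B := [set G o | o : option 'I_5] :|: [set L p | p : R * R].
have GB o : G o \in B by rewrite inE imset_f.
have LB p : L p \in B by rewrite inE orbC imset_f.
apply: (@pbd_trace_gdd5_type4 _ _ B).
  have HN u : #|through B None (Some u)| = 1.
    apply: (card_through1 (b := G u.1)); rewrite ?GN ?GP ?GB //.
    by move=> _ /setUP[]/imsetP[x _ ->]; rewrite ?LN // GP => _ /eqP->.
  move=> [[o z]|] [[o' z']|] _ _ // nuv; [|by rewrite through_sym].
  have [E|N] := eqVneq o o'.
    subst o'; apply: (card_through1 (b := G o)); rewrite ?GP ?GB //=.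
    move=> _ /setUP[]/imsetP[x _ ->]; rewrite ?GP ?LP /=; first by move=> /eqP->.
    by move=> /eqP E /eqP E'; rewrite E E' eqxx in nuv.
  have [p [Hp Hp' Hu]] := evP o o' z z' N.
  apply: (card_through1 (b := L p)); rewrite ?LP /= ?Hp ?Hp' ?eqxx ?LB //.
  move=> _ /setUP[]/imsetP[x _ ->]; rewrite ?GP ?LP /=.
    by move=> /eqP E /eqP E'; rewrite E E' eqxx in N.
  by move=> /eqP E /eqP E'; rewrite (Hu x).
(* The traces on [S] have m + e points for a full group, h + e for the truncated one, and 5 or 6 for
   a line, according to whether its point in the truncated group is kept. *)
move=> _ /setUP[]/imsetP[o _ ->]; rewrite card_option_prod !inE /=.
  case: o => [i|].
    suff -> : \sum_(u < 5) #|[set z | Some (Some u, z) \in G (Some i) :&: S]| +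
        #|[set z | Some (None, z) \in G (Some i) :&: S]| = #|R| by rewrite addnC.
    rewrite (bigD1 i) //= big1 => [|j ji].
      rewrite addn0 -[RHS]addn0; congr (_ + _).
        by apply: eq_card => z; rewrite !inE eqxx.
      by apply: eq_card0 => z; rewrite !inE.
    by apply: eq_card0 => z; rewrite !inE /=; case: eqP => // -[E]; rewrite E eqxx in ji.
  rewrite big1 => [|j ji]; last by apply: eq_card0 => z; rewrite !inE.
  rewrite add0n addnC.
  suff -> : #|[set z | Some (None, z) \in G None :&: S]| = h by [].
  by rewrite -[RHS](card_enum_rank_lt hm); apply: eq_card => z; rewrite !inE.
rewrite add0n (eq_bigr (fun=> 1)) => [|i _]; last first.
  rewrite -[RHS](cards1 (ev o (Some i))); apply: eq_card => z; by rewrite !inE andbT.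
rewrite sum_nat_const card_ord muln1.
have : #|[set z | Some (None, z) \in L o :&: S]| <= 1.
  rewrite -[X in _ <= X](cards1 (ev o None)); apply: subset_leq_card; apply/subsetP => z.
  by rewrite !inE => /andP[].
by case: #|_| => [|[]].
Qed.

(** * Difference families and designs checked by computation *)

Lemma card_ord_mem (n : nat) (l : seq nat) :
  uniq l -> all (fun x => x < n) l -> #|[set z : 'I_n | val z \in l]| = size l.
Proof.
move=> lU lt; rewrite cardsE cardE -(size_map val); apply: perm_size.
apply: uniq_perm => //; first by rewrite (map_inj_uniq val_inj) enum_uniq.
move=> x; apply/mapP/idP => [[z]|xl]; first by rewrite mem_enum => ? ->.
have xn := allP lt x xl.
by exists (Ordinal xn); rewrite ?mem_enum.
Qed.

Lemma count1_inj (T : eqType) (p : pred T) (s : seq T) (x y : T) :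
  count p s = 1 -> x \in s -> p x -> y \in s -> p y -> x = y.
Proof.
rewrite -size_filter => E xs px ys py.
have: x \in filter p s by rewrite mem_filter px.
have: y \in filter p s by rewrite mem_filter py.
by case: filter E => [|z []] // _; rewrite !inE => /eqP-> /eqP->.
Qed.

(* [x - a] modulo [n]; truncated subtraction makes this wrong when [a > n]. *)
Definition shift (n a x : nat) : nat := (x + (n - a)) %% n.

Lemma shiftE (n a x : nat) : a < n -> x < n ->
  shift n a x = if a <= x then x - a else x + n - a.
Proof.
rewrite /shift => an xn; case: leqP => ax.
  by rewrite (_ : x + (n - a) = x - a + n) ?modnDr ?modn_small //; lia.
by rewrite (_ : x + (n - a) = x + n - a) ?modn_small //; lia.
Qed.

Lemma shift_lt (n a x : nat) : a < n -> shift n a x < n.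
Proof. by move=> an; rewrite ltn_pmod //; lia. Qed.

(** Differences are invariant under translation, which allows a block to be based at any of its
    points. *)
Lemma shift_shift (n a x y : nat) : a < n -> x < n -> y < n ->
  shift n (shift n a x) (shift n a y) = shift n x y.
Proof.
move=> an xn yn; rewrite [LHS]shiftE ?shift_lt // !shiftE //.
by case: (leqP a x) => ?; case: (leqP a y) => ?; case: (leqP x y) => ?;
  case: leqP => ?; lia.
Qed.

(* [undup] because a base block can be fixed by a nonzero translation: the
   subgroup of order 5 is a base block of the designs on 5 (mod 20) points. *)
Definition translates (n : nat) (F : seq (seq nat)) : seq (seq nat) :=
  undup [seq sort leq [seq shift n a x | x <- b] | b <- F, a <- b].

(* The groups are the residue classes modulo [s]; they are points if [s = n]. *)
Definition cyclic_gdd_check (n s : nat) (F : seq (seq nat)) : bool :=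
  let L := translates n F in
  [&& 0 < s, s %| n,
    all (fun b => [&& size b == 5, uniq b, 0 \in b, all (fun x => x < n) b,
      all (fun a => sort leq [seq shift n a x | x <- b] \in L) b &
      all (fun x => (x == 0) || (x %% s != 0)) b]) L &
    all (fun d => (d %% s == 0) || (count (fun b => d \in b) L == 1)) (iota 0 n)].

Lemma shift_mod_eq0 (n s a x : nat) : s %| n -> a < n -> x < n ->
  (shift n a x %% s == 0) = (x %% s == a %% s).
Proof.
move=> /dvdnP[k ->] an xn; rewrite shiftE // -/(dvdn _ _); case: leqP => ax.
  by rewrite eqn_mod_dvd.
have ax' : a <= x + k * s by lia.
by rewrite -eqn_mod_dvd // addnC modnMDl.
Qed.

(** The list [L] holds the translates of the base blocks that pass through 0. The blocks through x
    are the l + x with l in [L], so those through x and y correspond to the members of [L]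
    containing y - x. *)
Lemma cyclic_gdd (n s : nat) (F : seq (seq nat)) : cyclic_gdd_check n s F ->
  exists B : {set {set 'I_n}}, gdd5 (fun x : 'I_n => x %% s) B.
Proof.
case/and4P=> s0 sn /allP HL /allP Hd; set L := translates n F in HL Hd.
(* [t l g] is the translate l + g. *)
pose t (l : seq nat) (g : 'I_n) := [set y : 'I_n | shift n g y \in l].
have LP l : l \in L -> [/\ size l = 5, uniq l, 0 \in l & all (fun x => x < n) l] /\
    (forall a, a \in l -> sort leq [seq shift n a x | x <- l] \in L) /\
    (forall x, x \in l -> x %% s = 0 -> x = 0).
  move=> /HL /and5P[/eqP ? ? ? ? /andP[/allP ? /allP H]]; split=> //; split=> // x xl E.
  by have := H x xl; rewrite E eqxx orbF => /eqP.
(* A block can be based at any of its points [x]; the closure of [L] that this requires is part of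
   the computed check. *)
have tN l (g x : 'I_n) : l \in L -> x \in t l g ->
    exists2 l', l' \in L & t l g = t l' x.
  move=> Ll; rewrite inE => xt.
  have [[_ _ _ /allP lt] [Hs _]] := LP l Ll.
  exists (sort leq [seq shift n (shift n g x) y | y <- l]); first exact: Hs.
  apply/setP=> y; rewrite !inE mem_sort; apply/idP/mapP => [yl|[c cl E]].
    by exists (shift n g y); rewrite ?shift_shift.
  suff -> : shift n g y = c by [].
  have cn := lt c cl.
  move: E; rewrite -(shift_shift (ltn_ord g) (ltn_ord x) (ltn_ord y)).
  have := shift_lt x (ltn_ord g); have := shift_lt y (ltn_ord g).
  move: (shift n g x) (shift n g y) => a b bn an.
  by rewrite !shiftE //; case: leqP => ?; case: leqP => ?; lia.
have tx l (x : 'I_n) : l \in L -> x \in t l x.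
  move=> /LP[[_ _ l0 _] _]; rewrite inE shiftE // leqnn subnn //.
pose B := [set t (nth [::] L (i : 'I_(size L))) g | i in 'I_(size L), g in 'I_n].
have BP b : b \in B -> exists l g, [/\ l \in L & b = t l g].
  by move=> /imset2P[i g _ _ ->]; exists (nth [::] L i), g; rewrite mem_nth.
have tB l g : l \in L -> t l g \in B.
  move=> Ll; have iL : index l L < size L by rewrite index_mem.
  by rewrite -(nth_index [::] Ll); apply: (imset2_f
    (fun (i : 'I_(size L)) g => t (nth [::] L i) g) (x := Ordinal iL)).
exists B; split.
- move=> _ /BP[l [g [Ll ->]]].
  have [[<- lU l0 lt] _] := LP l Ll; rewrite -(card_ord_mem lU lt).
  pose h (y : 'I_n) := Ordinal (shift_lt y (ltn_ord g)).
  have hinj : injective h.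
    move=> x y [E]; apply: val_inj; move: E.
    have := ltn_ord x; have := ltn_ord y; have := ltn_ord g; rewrite /= => ? ? ?.
    by rewrite !shiftE //; case: leqP => ?; case: leqP => ?; lia.
  by rewrite -[RHS](card_preimset _ hinj); apply: eq_card => y; rewrite !inE.
- move=> _ /BP[l [g [Ll ->]]] x y xt; have [l' Ll' ->] := tN _ _ _ Ll xt.
  rewrite inE => yl E; have [_ [_ H]] := LP _ Ll'.
  have /H : shift n x y \in l' by [].
  move=> H0; apply: val_inj; move: H0.
  have E0 : shift n x y %% s = 0 by apply/eqP; rewrite shift_mod_eq0 // E.
  by move=> /(_ E0); rewrite shiftE //=; case: leqP => ?; have := ltn_ord x; lia.
- move=> x y nxy; pose d := shift n x y.
  have dn : d < n by apply: shift_lt.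
  have d0 : d %% s != 0 by rewrite shift_mod_eq0 // eq_sym.
  have Hc : count (fun b => d \in b) L = 1.
    have := Hd d; rewrite mem_iota /= add0n (negbTE d0) /= => /(_ dn) /eqP //.
  have /hasP[l Ll dl] : has (fun b => d \in b) L by rewrite has_count Hc.
  apply: (card_through1 (b := t l x)); rewrite ?tx ?tB ?inE //.
  move=> _ /BP[l1 [g [Ll1 ->]]] xt; have [l2 Ll2 ->] := tN _ _ _ Ll1 xt.
  by rewrite inE => dl2; rewrite (count1_inj Hc Ll2 dl2 Ll dl).
Qed.

Lemma bibd5_cyclic (v : nat) (F : seq (seq nat)) : cyclic_gdd_check v v F -> bibd5 v.
Proof.
move=> /cyclic_gdd[B [B5 _ B1]]; exists 'I_v, B; split=> //; first exact: card_ord.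
by move=> x y nxy; apply: B1; rewrite !modn_small.
Qed.

(** The groups are the cosets of the subgroup of order 4 generated by [r]. *)
Lemma gdd5_type4_cyclic (r : nat) (F : seq (seq nat)) :
  cyclic_gdd_check (4 * r) r F -> gdd5_type4 r.
Proof.
move=> H; have /and4P[r0 _ _ _] := H; have [B HB] := cyclic_gdd H.
pose f (x : 'I_(4 * r)) : 'I_r := Ordinal (ltn_pmod x r0).
rewrite -[r]card_ord; apply: (@gdd5_type4_of _ _ f B) => [c|]; last first.
  case: HB => B5 Binj B1; split=> [//|b Bb x y xb yb /(congr1 val)|x y].
    exact: (Binj b Bb x y xb yb).
  exact: B1.
have lt4 (i : 'I_4) : i * r + c < 4 * r by have := ltn_ord c; have := ltn_ord i; nia.
rewrite -[RHS]card_ord -(card_imset predT (f := fun i => Ordinal (lt4 i))).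
  apply: eq_card => x; rewrite inE -val_eqE /=; apply/eqP/imsetP => [E|[i _ ->]].
    have x4 : x %/ r < 4 by rewrite ltn_divLR.
    by exists (Ordinal x4) => //; apply: val_inj; rewrite /= -E -divn_eq.
  by rewrite /= modnMDl modn_small.
move=> i j [/eqP]; rewrite eqn_add2r eqn_pmul2r // => /eqP; exact: val_inj.
Qed.

(** An exhaustive check of all pairs, for a design given by its full list of blocks. *)
Definition list_bibd_check (v : nat) (L : seq (seq nat)) : bool :=
  all (fun b => [&& size b == 5, uniq b & all (fun x => x < v) b]) L &&
  all (fun x => all (fun y => (x == y) ||
    (count (fun b => (x \in b) && (y \in b)) L == 1)) (iota 0 v)) (iota 0 v).

Lemma bibd5_list (v : nat) (L : seq (seq nat)) : list_bibd_check v L -> bibd5 v.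
Proof.
case/andP=> /allP HL /allP Hd.
pose t (l : seq nat) := [set x : 'I_v | val x \in l].
pose B := [set t (nth [::] L (i : 'I_(size L))) | i : 'I_(size L)].
have BP b : b \in B -> exists2 l, l \in L & b = t l.
  by move=> /imsetP[i _ ->]; exists (nth [::] L i); rewrite ?mem_nth.
have tB l : l \in L -> t l \in B.
  move=> Ll; have iL : index l L < size L by rewrite index_mem.
  by rewrite -(nth_index [::] Ll); apply: (imset_f _ (x := Ordinal iL)).
exists 'I_v, B; split; first exact: card_ord.
  by move=> _ /BP[l /HL /and3P[/eqP <- lU lt] ->]; apply: card_ord_mem.
move=> x y nxy.
have Hc : count (fun b => (val x \in b) && (val y \in b)) L = 1.
  have /allP/(_ (val y)) := Hd (val x) ltac:(by rewrite mem_iota /=).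
  by rewrite mem_iota /= val_eqE (negbTE nxy) => /(_ (ltn_ord y)) /eqP.
have /hasP[l Ll /andP[xl yl]] : has (fun b => (val x \in b) && (val y \in b)) L.
  by rewrite has_count Hc.
apply: (card_through1 (b := t l)); rewrite ?tB ?inE //.
move=> _ /BP[l1 Ll1 ->]; rewrite !inE => xl1 yl1.
by rewrite (count1_inj Hc Ll1 _ Ll) ?xl ?xl1.
Qed.

(** * Designs with few points *)

(** The projective plane of order 4, from a perfect difference set modulo 21. *)
Lemma bibd5_21 : bibd5 21.
Proof.
apply: (@bibd5_cyclic _
  [:: [:: 0; 1; 6; 8; 18]]).
by vm_compute.
Qed.

Lemma bibd5_41 : bibd5 41.
Proof.
apply: (@bibd5_cyclic _
  [:: [:: 0; 1; 15; 19; 25]; [:: 0; 2; 5; 13; 34]]).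
by vm_compute.
Qed.

Lemma bibd5_61 : bibd5 61.
Proof.
apply: (@bibd5_cyclic _
  [:: [:: 0; 1; 12; 17; 19]; [:: 0; 3; 26; 30; 51]; [:: 0; 6; 20; 28; 52]]).
by vm_compute.
Qed.

(** Three base blocks give 60 differences, and the subgroup of order 5 gives the remaining four
    nonzero ones. *)
Lemma bibd5_65 : bibd5 65.
Proof.
apply: (@bibd5_cyclic _
  [:: [:: 0; 1; 15; 22; 32]; [:: 0; 2; 6; 25; 62]; [:: 0; 8; 24; 35; 53];
      [:: 0; 13; 26; 39; 52]]).
by vm_compute.
Qed.

Lemma bibd5_81 : bibd5 81.
Proof.
apply: (@bibd5_cyclic _
  [:: [:: 0; 1; 22; 65; 79]; [:: 0; 4; 34; 44; 53]; [:: 0; 5; 31; 66; 73];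
      [:: 0; 6; 33; 58; 69]]).
by vm_compute.
Qed.

Lemma bibd5_141 : bibd5 141.
Proof.
apply: (@bibd5_cyclic _
  [:: [:: 0; 1; 85; 102; 116]; [:: 0; 2; 11; 38; 97]; [:: 0; 3; 94; 107; 126];
      [:: 0; 4; 12; 45; 66]; [:: 0; 5; 29; 78; 98]; [:: 0; 6; 28; 70; 80];
      [:: 0; 7; 23; 58; 88]]).
by vm_compute.
Qed.

Lemma bibd5_145 : bibd5 145.
Proof.
apply: (@bibd5_cyclic _
  [:: [:: 0; 1; 12; 57; 75]; [:: 0; 2; 7; 105; 121]; [:: 0; 3; 25; 39; 93];
      [:: 0; 4; 66; 101; 139]; [:: 0; 8; 23; 104; 125]; [:: 0; 9; 46; 59; 76];
      [:: 0; 19; 53; 80; 113]; [:: 0; 29; 58; 87; 116]]).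
by vm_compute.
Qed.

Lemma bibd5_161 : bibd5 161.
Proof.
apply: (@bibd5_cyclic _
  [:: [:: 0; 1; 101; 130; 149]; [:: 0; 2; 110; 137; 143];
      [:: 0; 3; 65; 75; 139]; [:: 0; 4; 44; 82; 150]; [:: 0; 5; 41; 71; 114];
      [:: 0; 7; 28; 63; 77]; [:: 0; 8; 45; 102; 152];
      [:: 0; 16; 39; 85; 119]]).
by vm_compute.
Qed.

Lemma bibd5_281 : bibd5 281.
Proof.
apply: (@bibd5_cyclic _
  [:: [:: 0; 1; 29; 134; 199]; [:: 0; 2; 131; 145; 164];
      [:: 0; 3; 20; 159; 277]; [:: 0; 5; 72; 174; 255];
      [:: 0; 6; 60; 76; 115]; [:: 0; 8; 165; 192; 239];
      [:: 0; 9; 44; 219; 241]; [:: 0; 10; 100; 151; 188];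
      [:: 0; 11; 63; 132; 236]; [:: 0; 12; 53; 85; 180];
      [:: 0; 13; 34; 195; 256]; [:: 0; 15; 58; 94; 204];
      [:: 0; 18; 66; 96; 224]; [:: 0; 23; 91; 137; 217]]).
by vm_compute.
Qed.

Lemma bibd5_301 : bibd5 301.
Proof.
apply: (@bibd5_cyclic _
  [:: [:: 0; 1; 36; 92; 215]; [:: 0; 2; 119; 174; 231];
      [:: 0; 3; 114; 160; 180]; [:: 0; 4; 29; 34; 283];
      [:: 0; 6; 80; 158; 242]; [:: 0; 7; 192; 219; 292];
      [:: 0; 8; 104; 128; 230]; [:: 0; 10; 98; 146; 261];
      [:: 0; 11; 69; 263; 289]; [:: 0; 13; 106; 145; 166];
      [:: 0; 14; 31; 202; 247]; [:: 0; 15; 43; 176; 239];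
      [:: 0; 19; 61; 94; 225]; [:: 0; 32; 142; 183; 250];
      [:: 0; 37; 90; 134; 237]]).
by vm_compute.
Qed.

Lemma bibd5_305 : bibd5 305.
Proof.
apply: (@bibd5_cyclic _
  [:: [:: 0; 1; 70; 187; 227]; [:: 0; 2; 86; 222; 225];
      [:: 0; 4; 11; 29; 171]; [:: 0; 5; 57; 201; 272];
      [:: 0; 6; 99; 121; 224]; [:: 0; 8; 23; 35; 274];
      [:: 0; 9; 73; 168; 185]; [:: 0; 10; 133; 209; 268];
      [:: 0; 13; 175; 243; 269]; [:: 0; 14; 141; 191; 254];
      [:: 0; 16; 205; 247; 277]; [:: 0; 19; 126; 214; 281];
      [:: 0; 20; 97; 131; 152]; [:: 0; 32; 156; 197; 245];
      [:: 0; 45; 101; 147; 252]; [:: 0; 61; 122; 183; 244]]).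
by vm_compute.
Qed.

Lemma bibd5_465 : bibd5 465.
Proof.
apply: (@bibd5_cyclic _
  [:: [:: 0; 1; 177; 232; 242]; [:: 0; 2; 82; 189; 194];
      [:: 0; 3; 42; 50; 416]; [:: 0; 4; 185; 286; 359];
      [:: 0; 6; 209; 281; 332]; [:: 0; 7; 164; 227; 294];
      [:: 0; 9; 143; 357; 452]; [:: 0; 11; 70; 316; 387];
      [:: 0; 12; 207; 310; 432]; [:: 0; 14; 97; 354; 422];
      [:: 0; 15; 90; 128; 159]; [:: 0; 16; 213; 269; 350];
      [:: 0; 17; 41; 216; 239]; [:: 0; 18; 58; 79; 104];
      [:: 0; 19; 138; 170; 430]; [:: 0; 20; 84; 250; 338];
      [:: 0; 26; 124; 161; 371]; [:: 0; 27; 168; 320; 356];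
      [:: 0; 28; 221; 265; 339]; [:: 0; 29; 121; 303; 380];
      [:: 0; 30; 132; 180; 349]; [:: 0; 34; 87; 163; 399];
      [:: 0; 60; 165; 261; 323]; [:: 0; 93; 186; 279; 372]]).
by vm_compute.
Qed.

Lemma bibd5_481 : bibd5 481.
Proof.
apply: (@bibd5_cyclic _
  [:: [:: 0; 1; 128; 185; 468]; [:: 0; 2; 56; 232; 401];
      [:: 0; 3; 10; 215; 431]; [:: 0; 4; 106; 133; 246];
      [:: 0; 5; 144; 415; 455]; [:: 0; 6; 278; 364; 396];
      [:: 0; 8; 103; 196; 334]; [:: 0; 9; 45; 190; 228];
      [:: 0; 11; 75; 229; 254]; [:: 0; 12; 120; 161; 282];
      [:: 0; 15; 292; 321; 422]; [:: 0; 16; 92; 126; 274];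
      [:: 0; 17; 78; 111; 174]; [:: 0; 18; 69; 313; 400];
      [:: 0; 19; 134; 286; 451]; [:: 0; 20; 173; 397; 434];
      [:: 0; 21; 163; 268; 365]; [:: 0; 22; 70; 248; 310];
      [:: 0; 23; 132; 304; 416]; [:: 0; 24; 245; 391; 437];
      [:: 0; 28; 83; 135; 208]; [:: 0; 35; 77; 166; 357];
      [:: 0; 39; 206; 264; 362]; [:: 0; 43; 122; 194; 381]]).
by vm_compute.
Qed.

(** The affine plane of order 5 without one point: the 20 differences of the base block are the
    elements of Z/24 outside the subgroup of order 4. *)
Lemma gdd5_type4_6 : gdd5_type4 6.
Proof.
apply: (@gdd5_type4_cyclic _
  [:: [:: 0; 1; 14; 16; 21]]).
by vm_compute.
Qed.

(** The 14 base blocks give 280 differences, the elements of Z/284 outside the subgroup of order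
    4. *)
Lemma gdd5_type4_71 : gdd5_type4 71.
Proof.
apply: (@gdd5_type4_cyclic _
  [:: [:: 0; 1; 106; 162; 170]; [:: 0; 2; 50; 67; 203];
      [:: 0; 3; 171; 192; 249]; [:: 0; 4; 79; 111; 125];
      [:: 0; 5; 193; 247; 277]; [:: 0; 6; 155; 182; 275];
      [:: 0; 10; 144; 243; 268]; [:: 0; 11; 34; 100; 152];
      [:: 0; 13; 62; 117; 264]; [:: 0; 18; 63; 208; 244];
      [:: 0; 19; 80; 157; 231]; [:: 0; 22; 69; 112; 197];
      [:: 0; 24; 110; 211; 240]; [:: 0; 28; 59; 98; 224]]).
by vm_compute.
Qed.

(* The elements of Z_3 x Z_3 x Z_5 are coded as [15 a + 5 b + c]; the blocks are
   the cosets of 0 x 0 x Z_5 and the translates of two base blocks. *)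
Lemma bibd5_45 : bibd5 45.
Proof.
pose shift3 a b c x := 15 * ((x %/ 15 + a) %% 3) + 5 * (((x %/ 5) %% 3 + b) %% 3)
  + (x %% 5 + c) %% 5.
pose trans F := flatten [seq [seq [seq shift3 a b c x | x <- F] | c <- iota 0 5]
  | a <- iota 0 3, b <- iota 0 3].
apply: (@bibd5_list _ ([seq iota (5 * i) 5 | i <- iota 0 9] ++
  trans [:: 0; 5; 11; 17; 37] ++ trans [:: 0; 7; 16; 30; 42])).
by vm_compute.
Qed.

(** * Hanani's theorem for blocks of size 5 *)

Lemma gdd5_type4_small (r : nat) : r <= 1 -> gdd5_type4 r.
Proof.
move=> r1; exists set0; split=> [b|b|[x i] [y j]]; rewrite ?inE //= => /eqP[].
by apply: val_inj => /=; have := ltn_ord x; have := ltn_ord y; lia.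
Qed.

(** The design on 4r + 1 points is itself a PBD with blocks of size 5, and the plane on 21 points
    provides the GDD of type 4^5 that fills them. *)
Lemma gdd5_type4_5_blocks (r : nat) : gdd5_type4 r -> gdd5_type4 (4 * r).+1.
Proof.
move=> H; have [T [B [<- B5 HB]]] := bibd5_of_gdd5_type4 H.
apply: (pbd_gdd5_type4 HB) => b /B5->.
exact: (@gdd5_type4_of_bibd5 5 bibd5_21).
Qed.

(** These are the values that neither recursion reaches, together with 5: it has the form 4k + 1
    with k = 1, but the only block of that design would again ask for the case 5. *)
Definition base_orders : seq nat :=
  [:: 5; 6; 10; 11; 15; 16; 20; 35; 36; 40; 70; 71; 75; 76; 116; 120].

Lemma gdd5_type4_base (r : nat) : r \in base_orders -> gdd5_type4 r.
Proof.
have H v : bibd5 (4 * v).+1 -> gdd5_type4 v := @gdd5_type4_of_bibd5 v.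
rewrite !inE; do 15 ?[case/orP => [/eqP->|]]; last move=> /eqP->.
all: first [exact: gdd5_type4_6 | exact: gdd5_type4_71 | apply: H].
all: first [exact: bibd5_21 | exact: bibd5_41 | exact: bibd5_45 | exact: bibd5_61
  | exact: bibd5_65 | exact: bibd5_81 | exact: bibd5_141 | exact: bibd5_145
  | exact: bibd5_161 | exact: bibd5_281 | exact: bibd5_301 | exact: bibd5_305
  | exact: bibd5_465 | exact: bibd5_481].
Qed.

(** The residues 1 and 5 express coprimality to 6. The field orders 9 and 16 serve for [r] from 46
    to 55 and from 80 to 96. *)
Definition td6_order (m : nat) : bool :=
  [|| m %% 6 == 1, m %% 6 == 5, m == 9 | m == 16].

Lemma has_td6_order (m : nat) : 1 < m -> td6_order m -> has_td6 m.
Proof.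
move=> m1 /or4P[] /eqP E.
- by apply: has_td6_coprime; rewrite // -coprime_modl E.
- by apply: has_td6_coprime; rewrite // -coprime_modl E.
- by rewrite E; apply: (@has_td6_primepow 3 2).
- by rewrite E; apply: (@has_td6_primepow 2 4).
Qed.

(* [r = 5 * m + h + e] for some [h <= m]. *)
Definition td_split (r m : nat) (e : bool) : bool :=
  [&& 1 < m, td6_order m, (m + e) %% 5 <= 1, 5 * m + e <= r & r <= 6 * m + e].

Definition splits (r : nat) : bool :=
  has (fun m => td_split r m false || td_split r m true) (iota 0 r).

Lemma splitsP (r : nat) : 1 < r -> r %% 5 <= 1 ->
  [\/ r \in base_orders,
      exists k, [/\ r = (4 * k).+1, k %% 5 <= 1 & 0 < k] |
      exists m e, td_split r m e].
Proof.
move=> r1 r5; case: (ltnP r 300) => r300.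
  have /allP/(_ r) : all (fun r => (r %% 5 <= 1) ==> [|| r \in base_orders,
      (r %% 4 == 1) && (r %/ 4 %% 5 <= 1) | splits r]) (iota 2 298).
    by vm_compute.
  rewrite mem_iota r1 r5 => /(_ r300) /or3P[||/hasP[m _ /orP[] Hm]].
  - by constructor 1.
  - move=> /andP[/eqP r4 k5]; constructor 2; exists (r %/ 4); split=> //; lia.
  - by constructor 3; exists m, false.
  - by constructor 3; exists m, true.
(* Adding 30 to [m] keeps its residues modulo 5 and 6 and adds 150 to 5m + e. For q = 2 the four
   choices below admit [t] up to 55, from 25 to 90, from 55 to 126, and from 96 on; a larger q only
   raises the upper ends. *)
constructor 3; pose q := r %/ 150; pose t := r %% 150.
have Hr : r = 150 * q + t by rewrite mulnC -divn_eq.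
have q2 : 2 <= q by rewrite leq_divRL.
have t150 : t < 150 by rewrite ltn_pmod.
rewrite /td_split /td6_order.
have [t55|t55] := leqP t 55; first by exists (30 * q - 1), true; lia.
have [t90|t90] := leqP t 90; first by exists (30 * q + 5), false; lia.
have [t126|t126] := leqP t 126; first by exists (30 * q + 11), false; lia.
by exists (30 * q + 19), true; lia.
Qed.

Lemma gdd5_type4_all (r : nat) : r %% 5 <= 1 -> gdd5_type4 r.
Proof.
elim/ltn_ind: r => r IH r5.
case: (leqP r 1) => [|r1]; first exact: gdd5_type4_small.
case: (splitsP r1 r5) => [|[k [E k5 k0]]|[m [e /and5P[m1 mtd m5 ler ger]]]].
- exact: gdd5_type4_base.
- by rewrite E; apply: gdd5_type4_5_blocks; apply: IH => //; lia.
pose h := r - (5 * m + e).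
have -> : r = 5 * m + h + e by rewrite /h; lia.
have H5 : gdd5_type4 5 by exact: gdd5_type4_base.
have H6 : gdd5_type4 6 by exact: gdd5_type4_base.
apply: (gdd5_type4_td (has_td6_order m1 mtd) _ H5 H6).
- by rewrite /h; lia.
- by apply: IH => //; case: e ler {ger m5 h} => /=; lia.
(* As h + e = r - 5m, its residue modulo 5 is that of [r]. *)
- by apply: IH; rewrite /h; case: (e) ler m5 ger => /=; lia.
Qed.

(** With n = 4r + 1, the residues 1 and 5 modulo 20 become 0 and 1 for r modulo 5. *)
Lemma bibd5_mod20 (n : nat) : n = 1 %[mod 20] \/ n = 5 %[mod 20] -> bibd5 n.
Proof.
move=> hn; have -> : n = (4 * (n %/ 4)).+1 by case: hn; lia.
by apply: bibd5_of_gdd5_type4; apply: gdd5_type4_all; case: hn; lia.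
Qed.

(** * From designs with block size 5 to configuration (1,5) *)

(** Double counting of the pairs of a block through [x] and another point [y] of it: each block has
    four such points, and each [y] lies in one such block. *)
Lemma bibd5_replication (T : finType) (B : {set {set T}}) (x : T) :
  (forall b, b \in B -> #|b| = 5) -> pbd B ->
  4 * #|[set b in B | x \in b]| = #|T|.-1.
Proof.
move=> B5 HB.
rewrite -(cardC1 x) -[RHS]sum1_card mulnC -sum_nat_const.
transitivity (\sum_(b in B | x \in b) \sum_(y in b | y != x) 1).
  apply: eq_big => [b|b]; rewrite !inE // => /andP[Bb xb].
  have := cardsD1 x b; rewrite B5 // xb => -[->].
  by rewrite -sum1_card; apply: eq_bigl => y; rewrite !inE andbC.
rewrite (exchange_big_dep (fun y => y != x)) /=; last by move=> b y _ /andP[].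
apply: eq_big => [y|y nyx]; first by rewrite !inE.
rewrite -[RHS](HB y x nyx) sum1_card; apply: eq_card => b.
by rewrite !inE unfold_in nyx andbT -andbA [(x \in b) && _]andbC.
Qed.

Theorem corollary7p1 (n : nat) (hn : 5 <= n)
    (hmod : n = 1 %[mod 20] \/ n = 5 %[mod 20]) :
  exists (T : finType) (P : {set {set T}}) (B : seq {set T}),
    is_gdd n 2 6 n ((n - 1) %/ 2) P B /\ has_configuration 1 5 P B.
Proof.
have [T [D [cT D5 HD]]] := bibd5_mod20 hmod.
pose side (s : bool) : {set bool * T} := [set p | p.1 == s].
(* Each side carries a copy of the design for each point [y] of the other
   side, and [y] is added to all the blocks of its copy. *)
pose blk (s : bool) (y : T) (b : {set T}) : {set bool * T} :=
  (~~ s, y) |: [set (s, x) | x in b].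
pose B := [seq blk u.1.1 u.1.2 u.2 |
  u <- enum [set u : bool * T * {set T} | u.2 \in D]].
pose P : {set {set bool * T}} := [set side true; side false].
have sideP s p : (p \in side s) = (p.1 == s) by rewrite inE.
have sideI s s' : (side s == side s') = (s == s').
  apply/eqP/eqP => [E|-> //]; have /card_gt0P[x _] : 0 < #|T| by lia.
  by have := sideP s' (s, x); rewrite -E sideP eqxx => /esym/eqP.
have PP G : G \in P -> exists s, G = side s.
  by rewrite !inE => /orP[] /eqP->; [exists true | exists false].
have Ps s : side s \in P by case: s; rewrite !inE eqxx ?orbT.
have sideE s : side s = [set (s, x) | x : T].
  apply/setP => -[s' x]; rewrite inE; apply/eqP/imsetP => [/= ->|[y _ [-> _]] //].
  by exists x.
have pair_inj (s : bool) : injective (fun x : T => (s, x)) by move=> x y [].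
have cside s : #|side s| = n by rewrite sideE (card_imset _ (@pair_inj s)) -cT; apply: eq_card => x; rewrite !inE.
have nN (s : bool) : (s == ~~ s) = false by case: s.
have Nn (s : bool) : (~~ s == s) = false by case: s.
have blkP s y b s' x : ((s', x) \in blk s y b) =
    if s' == s then x \in b else x == y.
  rewrite !inE xpair_eqE; have [->|N] := eqVneq s' s.
    by rewrite (mem_imset _ _ (@pair_inj s)); case: (s).
  have -> : s' == ~~ s by case: (s') (s) N => [] [].
  apply/orP/idP => [[//|/imsetP[z _ [E _]]]|->]; last by left.
  by rewrite E eqxx in N.
have cblk s y b : #|blk s y b| = #|b|.+1.
  rewrite cardsU1 (card_imset _ (@pair_inj s)).
  by case: imsetP => // -[x _ [E _]]; case: (s) E.
(* From here on [blk] is known only through [blkP] and [cblk], so [inE] no longer unfolds it. *)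
clearbody blk.
(* The side [s] is free, so that each count can begin with the copies lying on the side of the point
   considered. *)
have countB s (p : {set bool * T} -> bool) : count p B =
    \sum_y #|[set b in D | p (blk s y b)]| + \sum_y #|[set b in D | p (blk (~~ s) y b)]|.
  rewrite count_map -sum1_count big_enum_cond /=.
  pose F t := \sum_y #|[set b in D | p (blk t y b)]|.
  transitivity (\sum_t F t); last by rewrite big_bool; case: s => //; rewrite addnC.
  rewrite pair_big_dep /= (eq_bigr (fun v => \sum_(b in D | p (blk v.1 v.2 b)) 1)).
    by rewrite pair_big_dep /=; apply: eq_bigl => u; rewrite inE.
  by move=> v _; rewrite -sum1_card; apply: eq_bigl => b; rewrite inE.
have BP b : b \in B -> exists s y c, c \in D /\ b = blk s y c.
  move=> /mapP[[[s y] c]]; rewrite mem_enum inE /= => Dc ->.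
  by exists s, y, c.
(* A point serves as the added point only in its own copy, so a single index contributes; [sum_cst]
   treats the opposite case, where all n copies contribute equally. *)
have sum1y (A : {set {set T}}) (z : T) (f : T -> {set {set T}}) :
    (forall y, f y = if z == y then A else set0) -> \sum_y #|f y| = #|A|.
  move=> Hf; rewrite (bigD1 z) //= big1 ?addn0 => [|y yz]; first by rewrite Hf eqxx.
  by rewrite Hf eq_sym (negbTE yz) cards0.
have sum_cst (A : {set {set T}}) (f : T -> {set {set T}}) :
    (forall y, f y = A) -> \sum_y #|f y| = n * #|A|.
  by move=> Hf; rewrite (eq_bigr (fun=> #|A|)) ?sum_nat_const ?cT // => y _; rewrite Hf.
have r4 (x : T) : #|[set b in D | x \in b]| = (n - 1) %/ 4.
  have := bibd5_replication x D5 HD; rewrite cT; lia.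
exists (bool * T)%type, P, B; split; first split.
- by rewrite card_prod card_bool cT.
- apply/and3P; split.
  + apply/eqP/setP => -[s x]; rewrite inE; apply/bigcupP; exists (side s) => //.
    by rewrite sideP.
  + apply/trivIsetP => _ _ /PP[s ->] /PP[s' ->]; rewrite sideI => N.
    rewrite -setI_eq0; apply/eqP/setP => u; rewrite !inE.
    by apply/negP => /andP[/eqP E /eqP E']; rewrite -E -E' eqxx in N.
  + by apply/negP => /PP[s E]; have := cside s; rewrite -E cards0; lia.
- by rewrite cards2 sideI.
- by move=> _ /PP[s ->].
- by move=> _ /BP[s [y [c [Dc ->]]]]; rewrite cblk D5.
(* A point lies in (n-1)/4 blocks of each of the n copies on its side, and is added to all the
   blocks of its own copy on the other side. *)
- exists (n * ((n - 1) %/ 4) + #|D|) => -[s x]; rewrite (countB s).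
  congr (_ + _).
    rewrite -(r4 x); apply: sum_cst => y.
    by apply/setP=> b; rewrite !inE blkP eqxx.
  apply: (sum1y _ x) => y; apply/setP=> b; rewrite inE blkP nN.
  by case: eqP; rewrite ?inE ?andbT ?andbF.
- move=> _ [s x] [s' z] /PP[t ->]; rewrite !sideP /= => /eqP-> /eqP->.
  rewrite xpair_eqE eqxx /= => xz; rewrite (countB t) -[RHS]addn0; congr (_ + _).
    rewrite -[RHS]muln1 -(HD _ _ xz); apply: sum_cst => y.
    by apply/setP=> b; rewrite !inE !blkP eqxx.
  (* A block based on the other side has only one point on this side. *)
  rewrite big1 // => y _; apply: eq_card0 => b.
  rewrite !inE !blkP nN; apply/negbTE/negP => /and3P[_ /eqP E /eqP E'].
  by rewrite E E' eqxx in xz.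
- move=> _ _ [s x] [s' z] /PP[t ->] /PP[t' ->]; rewrite sideI !sideP /= => N /eqP-> /eqP->.
  have -> : t' = ~~ t by case: t t' N => [] [].
  (* Both residues give n = 1 modulo 4, so the two quarters add up to (n-1)/2 exactly. *)
  transitivity ((n - 1) %/ 4 + (n - 1) %/ 4); last by case: hmod; lia.
  rewrite (countB t); congr (_ + _).
    rewrite -(r4 x); apply: (sum1y _ z) => y; apply/setP=> b; rewrite !inE !blkP eqxx Nn.
    by case: eqP; rewrite ?inE ?andbT ?andbF.
  rewrite -(r4 z); apply: (sum1y _ x) => y; apply/setP=> b; rewrite !inE !blkP eqxx nN.
  by case: eqP; rewrite ?inE ?andbT ?andbF.
move=> _ /BP[s [y [c [Dc ->]]]]; exists (side (~~ s)), (side s); split=> //.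
- by rewrite sideI Nn.
- rewrite -(cards1 (~~ s, y)); apply: eq_card => -[s' x].
  rewrite inE blkP sideP inE xpair_eqE /=.
  by case: (s) s' => [] []; rewrite /= ?andbF ?andbT.
- rewrite -(D5 c Dc) -(card_imset _ (@pair_inj s)); apply: eq_card => -[s' x].
  rewrite inE blkP sideP /=; have [->|N] := eqVneq s' s.
    by rewrite andbT (mem_imset _ _ (@pair_inj s)).
  by rewrite andbF; apply/esym/negbTE/negP => /imsetP[z _ [E _]]; rewrite E eqxx in N.
Qed.
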